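(* For the linearized system under delay attack, if $\rho\in(0,0.5]$, then for all $\tau\in\mathbb{Z}^+$, $$\mathrm{ROS}(\rho,\tau)=\{\eta\;|\;0<\eta<1\}.$$
   Context: Real-time pricing model. In each pricing period $k$ a price $\lambda_k$ is set; the scheduled supply is $s(\lambda_k)$, with $s$ differentiable, increasing, $\dot s(\lambda_o)>0$; the price-responsive demand is $w(\lambda_k)$, with $w$ differentiable, decreasing, $\dot w(\lambda_o)<0$; there is also a bounded price-independent baseline demand $b_k$, treated as a disturbance. A dot denotes the first derivative, and $\lambda_o$ is the operating point of the linearization. The generation scheduling error $e_k$ is supply minus total demand. The price is updated by $\lambda_k=\lambda_{k-1}-\frac{2\eta}{\dot s(\lambda_o)-\dot w(\lambda_o)}e_{k-1}$ with gain $\eta\in(0,1)$, i.e. with controller transfer function $G_c(z)=\frac{2\eta}{(\dot s(\lambda_o)-\dot w(\lambda_o))(1-z^{-1})}$ and observation transfer function $H(z)=z^{-1}$. Delay attack $(\rho,\tau)$, with $\rho$ a constant in $[0,1]$ and $\tau$ a positive integer: a fraction $\rho$ of the consumers receive the old price $\lambda_k'=\lambda_{k-\tau}$ instead of $\lambda_k$, so the price-responsive demand becomes $\rho\,w(\lambda_{k-\tau})+(1-\rho)\,w(\lambda_k)$. Linearizing at $\lambda_o$ and collecting price-independent terms with the disturbance, the transfer function from price to error under attack is $G_p(z)=\dot s(\lambda_o)-z^{-\tau}\rho\,\dot w(\lambda_o)-(1-\rho)\dot w(\lambda_o)$. The closed-loop transfer function is $T_c(z)=\frac{G_c(z)G_p(z)}{1+G_c(z)G_p(z)H(z)}$,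 whose denominator (the system characteristic function), with $h=\left|\dot w(\lambda_o)/\dot s(\lambda_o)\right|>0$ the marginal demand-supply ratio, is $$P(z)=(h+1)z^{\tau+1}+\bigl(2\eta+2\eta(1-\rho)h-h-1\bigr)z^{\tau}+2\eta\rho h.$$ The system is stable if and only if all poles of $T_c(z)$ (i.e. all complex roots of $P(z)$) lie strictly inside the unit circle centered at the origin of the $z$-plane. The region of stability $\mathrm{ROS}(\rho,\tau)$ is the set of $\eta\in(0,1)$ such that the system is stable under the delay attack $(\rho,\tau)$ for all $h>0$. *)

(* Defs.v *)
From HB Require Import structures.
From mathcomp Require Import all_boot all_order all_algebra.
From mathcomp Require Import complex.
From mathcomp Require Import all_classical all_reals all_analysis.

Set Implicit Arguments.
Unset Strict Implicit.
Unset Printing Implicit Defensive.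

Import Order.TTheory GRing.Theory Num.Theory.
Import numFieldNormedType.Exports.
Local Open Scope classical_set_scope.
Local Open Scope ring_scope.
Local Open Scope complex_scope.

(* The baseline demand is not recorded: it enters the loop only as an exogenous
   disturbance, hence not the closed-loop transfer function. *)
Record pricing_model (R : realType) := PricingModel {
  supply : R -> R;
  demand : R -> R;
  op_price : R;
  supply_derivable : forall x, derivable supply x 1;
  supply_increasing : {homo supply : x y / x < y};
  supply_slope_gt0 : 0 < derive1 supply op_price;
  demand_derivable : forall x, derivable demand x 1;
  demand_decreasing : {homo demand : x y /~ x < y};
  demand_slope_lt0 : derive1 demand op_price < 0
}.

Section TransferFunctions.
Context {R : realType}.

(* Rational functions of z with complex coefficients. *)
Definition ratfun := {fraction {poly R[i]}}.

Definition rat_const (a : R) : ratfun := FracField.tofrac (a%:C)%:P.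
Definition z_inv : ratfun := (FracField.tofrac 'X)^-1.

Implicit Types (m : pricing_model R) (eta rho h : R) (tau : nat).

Definition supply_slope m : R := derive1 (supply m) (op_price m).
Definition demand_slope m : R := derive1 (demand m) (op_price m).

Definition marginal_ratio m : R := `|demand_slope m / supply_slope m|.

Definition controller_tf m eta : ratfun :=
  rat_const (2 * eta) /
  (rat_const (supply_slope m - demand_slope m) * (1 - z_inv)).

Definition observation_tf : ratfun := z_inv.

Definition price_error_tf m rho tau : ratfun :=
  rat_const (supply_slope m)
  - z_inv ^+ tau * rat_const (rho * demand_slope m)
  - rat_const ((1 - rho) * demand_slope m).

Definition closed_loop_tf m eta rho tau : ratfun :=
  controller_tf m eta * price_error_tf m rho tau /
  (1 + controller_tf m eta * price_error_tf m rho tau * observation_tf).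

(* The finite poles of f: the roots of its denominator in lowest terms. *)
Definition is_pole (f : ratfun) (z : R[i]) : Prop :=
  exists p q : {poly R[i]},
    [/\ q != 0, coprimep p q,
        f = FracField.tofrac p / FracField.tofrac q & root q z].

Definition stable m eta rho tau : Prop :=
  forall z : R[i], is_pole (closed_loop_tf m eta rho tau) z -> `|z| < 1.

(* [stable] depends on the model only through its ratio h, and every h > 0 is
   the ratio of some model (e.g. with affine supply and demand). *)
Definition ROS rho tau : set R :=
  [set eta | 0 < eta < 1 /\
     forall h, 0 < h ->
     forall m, marginal_ratio m = h -> stable m eta rho tau].

End TransferFunctions.

(* Main.v *)
Require Import Defs.
From mathcomp Require Import all_boot all_order all_algebra.
From mathcomp Require Import complex ring lra.
From mathcomp Require Import all_classical all_reals all_analysis.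

Import Order.TTheory GRing.Theory Num.Theory.
Local Open Scope classical_set_scope.
Local Open Scope ring_scope.

(** Clearing denominators, the closed loop is a quotient of polynomials whose
    denominator is the trinomial [a z^(tau+1) + b z^tau + c], so poles are among
    its roots.  Its leading coefficient is dominant, [|b| + |c| < a], which forces
    every root into the open unit disk; [rho <= 1/2] gives [c < a + b] and
    [eta < 1] gives [c < a - b]. *)

(** If [1 <= |z|], then [|c| <= |c| |z|^n], so the equation bounds [|a| |z|^(n+1)] by
    [(|b| + |c|) |z|^n]. It is also at least [|a| |z|^n], and cancelling [|z|^n] contradicts
    dominance. *)
Lemma dominant_trinomial_root_lt1 (F : numDomainType) (n : nat) (a b c z : F) :
  `|b| + `|c| < `|a| -> a * z ^+ n.+1 + b * z ^+ n + c = 0 -> `|z| < 1.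
Proof.
move=> abc /eqP; rewrite -addrA addr_eq0 => /eqP rz.
rewrite real_ltNge ?normr_real ?real1 //; apply/negP => z1.
have zn1 : 1 <= `|z| ^+ n by rewrite exprn_ege1.
have := congr1 Num.norm rz; rewrite normrN normrM normrX => e.
have le1 : `|a| * `|z| ^+ n.+1 <= (`|b| + `|c|) * `|z| ^+ n.
  rewrite e mulrDl (le_trans (ler_normD _ _)) // normrM normrX lerD2l.
  by rewrite ler_peMr.
have le2 : `|a| * `|z| ^+ n <= `|a| * `|z| ^+ n.+1.
  by rewrite ler_wpM2l // ler_weXn2l.
have := le_trans le2 le1.
by rewrite ler_pM2r ?(lt_le_trans ltr01) // lt_geF.
Qed.

(** Cross-multiplying gives [p v = u q], and Gauss's lemma removes [p]. Hence every pole is a root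
    of any denominator representing the fraction. *)
Lemma coprimep_frac_dvdp (F : fieldType) (p q u v : {poly F}) :
  q != 0 -> v != 0 -> coprimep p q ->
  FracField.tofrac p / FracField.tofrac q =
    FracField.tofrac u / FracField.tofrac v ->
  q %| v.
Proof.
move=> q0 v0 pq /eqP.
rewrite eqr_div ?tofrac_eq0 // -!rmorphM tofrac_eq => /eqP pv.
rewrite coprimep_sym in pq.
by rewrite -(Gauss_dvdpr _ pq) pv dvdp_mull.
Qed.

Lemma feedback_loop_tfE (D : comNzRingType) (F : fieldType)
    (f : {rmorphism D -> F}) (a g s u v x : D) (n : nat) :
  f a != 0 -> f x != 0 -> f x != 1 ->
  f (a * (x - 1) * x ^+ n + g * ((s - u) * x ^+ n - v)) != 0 ->
  let L := f g / (f a * (1 - (f x)^-1)) * (f s - (f x)^-1 ^+ n * f v - f u) in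
  L / (1 + L * (f x)^-1) =
    f (g * ((s - u) * x ^+ n - v) * x) /
    f (a * (x - 1) * x ^+ n + g * ((s - u) * x ^+ n - v)).
Proof.
rewrite !(rmorphD, rmorphN, rmorphM, rmorphXn, rmorph1) exprVn.
have := expf_neq0 n (x := f x); set y := f x ^+ n.
(* Only the images under [f] and the power [y] matter now; as free variables they are atoms for
   [field]. *)
move: (f a) (f g) (f s) (f u) (f v) (f x) y => {}a {}g {}s {}u {}v {}x y y0.
move=> a0 x0; have {}y0 := y0 x0; rewrite -subr_eq0 => x1 P0 L.
have LE : L = g * ((s - u) * y - v) * x / (a * (x - 1) * y).
  by rewrite /L; field; rewrite x0 x1 a0 y0.
have DE : 1 + L / x =
    (a * (x - 1) * y + g * ((s - u) * y - v)) / (a * (x - 1) * y).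
  by rewrite LE; field; rewrite x0 x1 a0 y0.
by rewrite DE LE; field; rewrite x1 a0 y0 P0.
Qed.

Lemma horner_trinomial (F : comNzRingType) (a g s u v x : F) (n : nat) :
  (a%:P * ('X - 1) * 'X^n + g%:P * ((s%:P - u%:P) * 'X^n - v%:P)).[x] =
  a * x ^+ n.+1 + (g * (s - u) - a) * x ^+ n + - (g * v).
Proof.
rewrite !(hornerD, hornerN, hornerM, hornerC, hornerX, hornerXn) exprS.
by ring.
Qed.

Section ClosedLoop.
Context {R : realType}.
Implicit Types (m : pricing_model R) (eta rho : R) (tau : nat).

(** This is [price_error_tf] cleared of its delay by the factor [z^tau]. *)
Definition loop_numerator m rho tau : {poly R[i]} :=
  (((supply_slope m)%:C%C)%:P - (((1 - rho) * demand_slope m)%:C%C)%:P) * 'X^tau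
  - ((rho * demand_slope m)%:C%C)%:P.

(** With [demand_slope m = - h * supply_slope m], this is [supply_slope m] times the system
    characteristic function P(z). *)
Definition characteristic_poly m eta rho tau : {poly R[i]} :=
  ((supply_slope m - demand_slope m)%:C%C)%:P * ('X - 1) * 'X^tau
  + ((2 * eta)%:C%C)%:P * loop_numerator m rho tau.

Lemma slope_gap_gt0 m : 0 < supply_slope m - demand_slope m.
Proof.
by rewrite subr_gt0 (lt_trans (demand_slope_lt0 m)) ?(supply_slope_gt0 m).
Qed.

Lemma characteristic_poly_root_lt1 m eta rho tau (z : R[i]) :
  0 < rho <= 2^-1 -> 0 < eta < 1 ->
  root (characteristic_poly m eta rho tau) z -> `|z| < 1.
Proof.
move=> /andP[rho0 rho1] /andP[eta0 eta1] /rootP.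
have S0 : 0 < supply_slope m := supply_slope_gt0 m.
have W0 : demand_slope m < 0 := demand_slope_lt0 m.
rewrite /characteristic_poly /loop_numerator.
rewrite horner_trinomial.
set S := supply_slope m in S0 *; set W := demand_slope m in W0 *.
pose a := S - W; pose c := - (2 * eta * (rho * W)).
pose b := 2 * eta * (S - (1 - rho) * W) - a.
move=> Pz.
apply: (@dominant_trinomial_root_lt1 _ tau (a%:C)%C (b%:C)%C (c%:C)%C); last first.
  by rewrite -[RHS]Pz /b /a /c !(rmorphB, rmorphN, rmorphM).
rewrite !normc_def /= expr0n /= !addr0 !sqrtr_sqr -rmorphD ltcR.
have a0 : 0 < a by rewrite /a; lra.
have rW0 : rho * W < 0 by rewrite pmulr_rlt0.
have c0 : 0 < c by rewrite /c oppr_gt0 pmulr_rlt0 ?mulr_gt0.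
rewrite (gtr0_norm a0) (gtr0_norm c0) -ltrBrDr ltr_norml.
apply/andP; split.
  (* Here [a + b - c = 2 eta (S - (1 - 2 rho) W)]; the bound [rho <= 1/2] makes [- (1 - 2 rho) W]
     nonnegative. *)
  have rW1 : (1 - 2 * rho) * W <= 0 by rewrite mulr_ge0_le0 //; lra.
  have pos : 0 < eta * (S - (1 - 2 * rho) * W) by rewrite mulr_gt0 //; lra.
  rewrite -subr_gt0 (_ : _ - _ = 2 * (eta * (S - (1 - 2 * rho) * W))) ?(pmulr_rgt0 _ (ltr0Sn _ 1)) //.
  by rewrite /b /a /c; ring.
(* In [a - b - c] the terms in [rho] cancel, leaving [2 (S - W) (1 - eta)]. *)
have pos : 0 < (S - W) * (1 - eta) by rewrite mulr_gt0 // subr_gt0.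
rewrite -subr_gt0 (_ : _ - _ = 2 * ((S - W) * (1 - eta))) ?(pmulr_rgt0 _ (ltr0Sn _ 1)) //.
by rewrite /b /a /c; ring.
Qed.

Lemma closed_loop_tfE m eta rho tau :
  characteristic_poly m eta rho tau != 0 ->
  closed_loop_tf m eta rho tau =
    FracField.tofrac
      (((2 * eta)%:C%C)%:P * loop_numerator m rho tau * 'X) /
    FracField.tofrac (characteristic_poly m eta rho tau).
Proof.
move=> D0.
have x0 : FracField.tofrac ('X : {poly R[i]}) != 0.
  by rewrite tofrac_eq0 polyX_eq0.
have x1 : FracField.tofrac ('X : {poly R[i]}) != 1.
  by rewrite -tofrac1 tofrac_eq -subr_eq0 polyXsubC_eq0.
have a0 : rat_const (supply_slope m - demand_slope m) != 0.
  by rewrite tofrac_eq0 polyC_eq0 fmorph_eq0 gt_eqF ?slope_gap_gt0.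
rewrite -tofrac_eq0 in D0.
rewrite /closed_loop_tf /controller_tf /price_error_tf /observation_tf /z_inv.
pose r (x : R) : {poly R[i]} := (x%:C%C)%:P.
exact: (@feedback_loop_tfE _ _ (@FracField.tofrac {poly R[i]})
  (r (supply_slope m - demand_slope m)) (r (2 * eta)) (r (supply_slope m))
  (r ((1 - rho) * demand_slope m)) (r (rho * demand_slope m)) 'X tau a0 x0 x1 D0).
Qed.

Lemma closed_loop_stable m eta rho tau :
  0 < rho <= 2^-1 -> 0 < eta < 1 -> stable m eta rho tau.
Proof.
move=> hrho heta z [p [q [q0 pq Tpq qz]]].
have P0 : characteristic_poly m eta rho tau != 0.
  apply/eqP => P0.
  (* The zero polynomial would have the root 1, which is not inside the open disk. *)
  have := @characteristic_poly_root_lt1 m eta rho tau 1 hrho heta.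
  by rewrite P0 root0 normr1 ltxx => /(_ isT).
apply: (@characteristic_poly_root_lt1 m eta rho tau z hrho heta).
(* As divisibility by [X - z], the root passes from [q] to its multiple, the characteristic
   polynomial. *)
move: qz; rewrite -!dvdp_XsubCl => /dvdp_trans; apply.
by apply: (@coprimep_frac_dvdp _ p q _ _ q0 P0 pq); rewrite -Tpq closed_loop_tfE.
Qed.

End ClosedLoop.

Theorem proposition5 (R : realType) (rho : R) (hrho : 0 < rho <= 2^-1)
    (tau : nat) (htau : (0 < tau)%N) :
  ROS rho tau = [set eta : R | 0 < eta < 1].
Proof.
apply/seteqP; split=> [eta [] //|eta heta]; split=> // h _ m _.
exact: closed_loop_stable.
Qed.
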